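(* Let $\alpha$ be any finite set and $\nu$ any involution on $\alpha$. The linking matrix $L:P(\alpha,\nu,n)\to\bigoplus_{1\le i\le j\le n}\pi_{ij}$ is a finite type invariant of degree $1$, and the direct sum $L\oplus\iota: P(\alpha,\nu,n)\to\bigoplus_{1\le i\le j\le n}\pi_{ij}\oplus\mathbb{Z}$ of the linking matrix and the constant map $\iota\equiv 1$ is the universal finite type invariant of degree $1$ for cyclic equivalence classes of $n$-component nanophrases over $\alpha$.
   Context: Nanophrases. An $\alpha$-alphabet is a finite set $\mathcal A$ of letters with a map $A\mapsto |A|\in\alpha$ (the projection). An $n$-component nanophrase over $\alpha$ is an $\alpha$-alphabet $\mathcal A$ together with a sequence of $n$ (possibly empty) words on $\mathcal A$, written separated by ''$|$'', such that every letter of $\mathcal A$ occurs exactly twice in total. An isomorphism is a projection-preserving bijection of alphabets carrying the $i$th word to the $i$th word for all $i$. $\nu$-shift move on the $i$th component: if that component is empty or a single letter, nothing changes; otherwise write it as $Ax$ with $A$ its first letter and replace it by $xA$; moreover, if $x$ contains $A$, then $|A|$ is replaced by $\nu(|A|)$; otherwise projections are unchanged. Cyclic equivalence is the equivalence relation generated by isomorphisms and $\nu$-shift moves; $P(\alpha,\nu,n)$ is the set of cyclic equivalence classes of $n$-component nanophrases over $\alpha$. Singular letters. Let $\alpha^*=\{a^*\mid a\in\alpha\}$ be a disjoint copy of $\alpha$ and extend $\nu$ by $\nu(a^* )=\nu(a)^*$. A letter with projection in $\alpha^*$ is called singular (written $A^*$). $P_m(\alpha,\nu,n)$ is the set of cyclic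 equivalence classes of $n$-component nanophrases over $\alpha\cup\alpha^*$ with exactly $m$ singular letters, and $\mathcal P(\alpha,\nu,n)=\bigcup_{m\ge0}P_m(\alpha,\nu,n)$. An invariant is a map $u:P(\alpha,\nu,n)\to G$ to an abelian group; it has a (well-defined) extension $\hat u:\mathcal P(\alpha,\nu,n)\to G$ determined by $\hat u=u$ on $P_0(\alpha,\nu,n)=P(\alpha,\nu,n)$ and $\hat u(xA^*yA^*z)=\hat u(xAyAz)-\hat u(xyz)$, where $A$ is a non-singular letter with $|A|^*=|A^*|$ and $x,y,z$ are arbitrary sequences possibly including ''$|$''. The map $u$ is a finite type invariant if there is $m\ge0$ such that $\hat u(p)=0$ for all $p$ with more than $m$ singular letters; the minimal such $m$ is its degree. A finite type invariant $u:P(\alpha,\nu,n)\to G$ of degree $m$ is universal if for every abelian group $H$ and every finite type invariant $v:P(\alpha,\nu,n)\to H$ of degree at most $m$ there is a homomorphism $f:G\to H$ with $v=f\circ u$. Linking matrix. For $1\le i<j\le n$ let $\pi_{ij}$ be the free abelian group generated by the elements of $\alpha$; for $1\le i\le n$ let $\pi_{ii}$ be the abelian group generated by the elements of $\alpha$ with relations $a=\nu(a)$ for all $a\in\alpha$. For a nanophrase $p$ and $i<j$ let $\mathcal A_{ij}(p)$ be the set of letters with one occurrence in the $i$th and the other in the $j$th component of $p$, and let $\mathcal A_{ii}(p)$ be the set of letters with both occurrences in the $i$th component. Put $l_{ij}(p)=\sum_{A\in\mathcal A_{ij}(p)}|A|\in\pi_{ij}$ for $i\le j$. The linking matrix $L(p)$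 is the symmetric $n\times n$ matrix with entries $l_{ij}(p)$, regarded as an element of $\bigoplus_{i\le j}\pi_{ij}$; it depends only on the cyclic equivalence class of $p$. The map $\iota:P(\alpha,\nu,n)\to\mathbb{Z}$ is $\iota(p)=1$ for all $p$.
   Formalization: The set α is assumed nonempty and n at least 1: if α is empty or n = 0, the only nanophrase is the empty one, so L and L⊕ι have degree 0 and the claim ''degree 1'' fails. *)

(* Defs.v *)
From HB Require Import structures.
From mathcomp Require Import all_boot all_order all_algebra.
From mathcomp Require Import boolp.

Set Implicit Arguments.
Unset Strict Implicit.
Unset Printing Implicit Defensive.

Import GRing.Theory.

(** * Nanophrases *)

Record nanophrase (alpha : Type) (n : nat) := Nanophrase {
  letters : finType;
  proj : letters -> alpha;
  word : 'I_n -> seq letters;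
  word_twice : forall A : letters, \sum_(i < n) count_mem A (word i) = 2
}.

Definition isomorphic (alpha : Type) (n : nat) (p q : nanophrase alpha n) : Prop :=
  exists f : letters p -> letters q,
    [/\ bijective f,
        forall A, proj (f A) = proj A
      & forall i, word q i = map f (word p i)].

Definition reproject (alpha beta : Type) (n : nat) (p : nanophrase alpha n)
    (f : letters p -> beta) : nanophrase beta n :=
  Nanophrase f (@word_twice alpha n p).

(** The word at [i] is rotated by one letter (which does nothing to an empty or
    one-letter word); the projection of its first letter [A] changes only if
    [A] occurs again in the rest [x] of that word. *)

Definition shift_word (alpha : Type) (n : nat) (p : nanophrase alpha n) (i j : 'I_n) :
    seq (letters p) :=
  if j == i then rot 1 (word p i) else word p j.

Definition shift_proj (alpha : Type) (nu : alpha -> alpha) (n : nat)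
    (p : nanophrase alpha n) (i : 'I_n) (B : letters p) : alpha :=
  if word p i is A :: x then
    if (B == A) && (A \in x) then nu (proj B) else proj B
  else proj B.

Lemma shift_word_twice (alpha : Type) (n : nat) (p : nanophrase alpha n)
    (i : 'I_n) (A : letters p) :
  \sum_(j < n) count_mem A (shift_word p i j) = 2.
Proof.
rewrite -[RHS](word_twice A); apply: eq_bigr => j _; rewrite /shift_word.
by case: eqP => // ->; apply/permP; rewrite perm_rot.
Qed.

Definition shift (alpha : Type) (nu : alpha -> alpha) (n : nat)
    (p : nanophrase alpha n) (i : 'I_n) : nanophrase alpha n :=
  Nanophrase (shift_proj nu i) (@shift_word_twice alpha n p i).

Inductive cyclic_equiv (alpha : Type) (nu : alpha -> alpha) (n : nat) :
    nanophrase alpha n -> nanophrase alpha n -> Prop :=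
| cyclic_iso p q : isomorphic p q -> cyclic_equiv nu p q
| cyclic_shift p i : cyclic_equiv nu p (shift nu p i)
| cyclic_refl p : cyclic_equiv nu p p
| cyclic_sym p q : cyclic_equiv nu p q -> cyclic_equiv nu q p
| cyclic_trans p q r :
    cyclic_equiv nu p q -> cyclic_equiv nu q r -> cyclic_equiv nu p r.

(** A map on cyclic equivalence classes is a map on nanophrases that is constant
    on each class. *)

Definition cyclic_invariant (alpha : Type) (nu : alpha -> alpha) (n : nat) (G : Type)
    (u : nanophrase alpha n -> G) : Prop :=
  forall p q, cyclic_equiv nu p q -> u p = u q.

(** * Singular letters *)

(** [alpha + alpha] is the disjoint union of [alpha] and its starred copy:
    [inl a] is the symbol a and [inr a] is the symbol a-star. *)

Definition nu_star (alpha : Type) (nu : alpha -> alpha) (x : alpha + alpha) :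
    alpha + alpha :=
  match x with inl a => inl (nu a) | inr a => inr (nu a) end.

Definition starred (alpha : Type) (x : alpha + alpha) : bool :=
  if x is inr _ then true else false.

Definition unstar (alpha : Type) (x : alpha + alpha) : alpha + alpha :=
  match x with inl a => inl a | inr a => inl a end.

Definition singular (alpha : Type) (n : nat) (p : nanophrase (alpha + alpha) n)
    (A : letters p) : bool :=
  starred (proj A).

Definition num_singular (alpha : Type) (n : nat) (p : nanophrase (alpha + alpha) n) : nat :=
  #|[set A : letters p | singular A]|.

Definition plain (alpha : Type) (n : nat) (p : nanophrase alpha n) :
    nanophrase (alpha + alpha) n :=
  reproject (fun A : letters p => inl (proj A)).

(** From xA*yA*z to xAyAz. *)

Definition desingularize (alpha : Type) (n : nat) (p : nanophrase (alpha + alpha) n)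
    (A : letters p) : nanophrase (alpha + alpha) n :=
  reproject (fun B : letters p => if B == A then unstar (proj B) else proj B).

(** From xAyAz to xyz. *)

Definition delete_word (alpha : Type) (n : nat) (p : nanophrase alpha n)
    (A : letters p) (i : 'I_n) : seq {B : letters p | B != A} :=
  pmap insub (word p i).

Lemma delete_word_twice (alpha : Type) (n : nat) (p : nanophrase alpha n)
    (A : letters p) (B : {B : letters p | B != A}) :
  \sum_(i < n) count_mem B (delete_word A i) = 2.
Proof.
rewrite -[RHS](word_twice (val B)); apply: eq_bigr => i _.
rewrite /delete_word; elim: (word p i) => //= C w IHw.
case: insubP => [D _ <-|nCA] /=; first by rewrite IHw.
rewrite IHw; case: eqP => // CB.
by case/negP: nCA; rewrite CB; exact: (valP B).
Qed.

Definition delete (alpha : Type) (n : nat) (p : nanophrase alpha n) (A : letters p) :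
    nanophrase alpha n :=
  Nanophrase (fun B : {B : letters p | B != A} => proj (val B))
             (@delete_word_twice alpha n p A).

(** * Finite type invariants *)

Local Open Scope ring_scope.

Definition is_extension (alpha : Type) (nu : alpha -> alpha) (n : nat) (G : zmodType)
    (u : nanophrase alpha n -> G) (uhat : nanophrase (alpha + alpha) n -> G) : Prop :=
  [/\ cyclic_invariant (nu_star nu) uhat,
      forall p, uhat (plain p) = u p
    & forall p (A : letters p), singular A ->
        uhat p = uhat (desingularize A) - uhat (delete A)].

(** The extension of a cyclic invariant exists and is unique: every letter occurs
    twice, so the last clause above resolves singular letters one at a time. *)

Definition extension_vanishes_above (alpha : Type) (nu : alpha -> alpha) (n : nat) (G : zmodType)
    (u : nanophrase alpha n -> G) (m : nat) : Prop :=
  exists2 uhat, is_extension nu u uhat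
              & forall p, (m < num_singular p)%N -> uhat p = 0.

Definition finite_type_of_degree (alpha : Type) (nu : alpha -> alpha) (n : nat)
    (G : zmodType) (u : nanophrase alpha n -> G) (m : nat) : Prop :=
  [/\ cyclic_invariant nu u,
      extension_vanishes_above nu u m
    & forall k, extension_vanishes_above nu u k -> (m <= k)%N].

Definition universal_of_degree (alpha : Type) (nu : alpha -> alpha) (n : nat)
    (G : zmodType) (u : nanophrase alpha n -> G) (m : nat) : Prop :=
  finite_type_of_degree nu u m /\
  forall (H : zmodType) (v : nanophrase alpha n -> H) (k : nat),
    (k <= m)%N -> finite_type_of_degree nu v k ->
    exists f : {additive G -> H}, forall p, v p = f (u p).

(** * The linking matrix *)

(** The free abelian group on the finite set [alpha]. *)

Definition free_ab (alpha : finType) : zmodType := {ffun alpha -> int}.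

Definition gen (alpha : finType) (a : alpha) : free_ab alpha :=
  [ffun b => (b == a)%:R].

(** The subgroup of [free_ab alpha] generated by the elements a - nu a. *)

Definition relations (alpha : finType) (nu : alpha -> alpha) : {pred free_ab alpha} :=
  fun x => `[< exists c : alpha -> int,
                 x = \sum_(a : alpha) (gen a - gen (nu a)) *~ c a >].

Lemma relations_zmod_closed (alpha : finType) (nu : alpha -> alpha) :
  zmod_closed (relations nu).
Proof.
split=> [|x y /asboolP[c ->] /asboolP[d ->]]; apply/asboolP.
  by exists (fun=> 0); rewrite big1 // => a _; rewrite mulr0z.
exists (fun a => c a - d a); rewrite -sumrB.
by apply: eq_bigr => a _; rewrite mulrzBr.
Qed.

HB.instance Definition _ (alpha : finType) (nu : alpha -> alpha) :=
  GRing.isZmodClosed.Build (free_ab alpha) (relations nu) (relations_zmod_closed nu).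

Definition quot_ab (alpha : finType) (nu : alpha -> alpha) : zmodType :=
  {ideal_quot (relations nu)}.

Definition quot_gen (alpha : finType) (nu : alpha -> alpha) (a : alpha) : quot_ab nu :=
  (\pi_(quot_ab nu) (gen a))%qT.

Definition upper_pair (n : nat) : finType := {ij : 'I_n * 'I_n | (ij.1 < ij.2)%N}.

(** The direct sum of the groups pi_ij over i <= j: first the summands with
    i < j, each free on [alpha], then the diagonal ones. *)

Definition linking_group (alpha : finType) (nu : alpha -> alpha) (n : nat) : zmodType :=
  ({ffun upper_pair n -> free_ab alpha} * {ffun 'I_n -> quot_ab nu})%type.

Definition off_diag_letters (alpha : Type) (n : nat) (p : nanophrase alpha n)
    (i j : 'I_n) : {set letters p} :=
  [set A | (count_mem A (word p i) == 1%N) && (count_mem A (word p j) == 1%N)].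

Definition diag_letters (alpha : Type) (n : nat) (p : nanophrase alpha n)
    (i : 'I_n) : {set letters p} :=
  [set A | count_mem A (word p i) == 2%N].

Definition linking_matrix (alpha : finType) (nu : alpha -> alpha) (n : nat)
    (p : nanophrase alpha n) : linking_group nu n :=
  ([ffun ij : upper_pair n =>
      \sum_(A in off_diag_letters p (val ij).1 (val ij).2) gen (proj A)],
   [ffun i : 'I_n => \sum_(A in diag_letters p i) quot_gen nu (proj A)]).

Definition iota1 (alpha : Type) (n : nat) (p : nanophrase alpha n) : int := 1.

Definition direct_sum (alpha : Type) (n : nat) (G H : zmodType)
    (u : nanophrase alpha n -> G) (v : nanophrase alpha n -> H)
    (p : nanophrase alpha n) : (G * H)%type :=
  (u p, v p).

(* Main.v *)
(** The linking matrix is a sum over the letters A of a weight that depends only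
    on |A| and on the components that A meets; hence so is its extension, in
    which a letter contributes only when no other letter is singular.
    Conversely, let v have degree at most 1.  Making two letters A and B of p
    singular gives v(p) - v(p\A) - v(p\B) + v(p\{A,B}) = 0, so by induction
    on the number of letters v(p) is v(empty) plus the sum over the letters A of
    v(A alone) - v(empty).  Shifting the one-letter phrase AA shows that the
    latter term respects the relations a = nu(a) of the diagonal summands, so
    v factors through the linking matrix together with the constant 1. *)

From HB Require Import structures.
Require Import Defs.
From mathcomp Require Import all_boot all_order all_algebra.
From mathcomp Require Import boolp.

Set Implicit Arguments.
Unset Strict Implicit.
Unset Printing Implicit Defensive.

Import GRing.Theory.

Local Open Scope ring_scope.

(** * Multiplicities *)

Definition multiplicity (alpha : Type) (n : nat) (p : nanophrase alpha n)
    (A : letters p) : {ffun 'I_n -> nat} :=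
  [ffun i => count_mem A (word p i)].

(** The profile of a letter with one occurrence in component [i] and one in [j]; adding the two
    indicators gives 2 when [i = j]. *)
Definition pair_multiplicity (n : nat) (i j : 'I_n) : {ffun 'I_n -> nat} :=
  [ffun k => ((k == i) + (k == j))%N].

Lemma sum_pair_multiplicity (n : nat) (i j : 'I_n) :
  (\sum_k pair_multiplicity i j k = 2)%N.
Proof.
under eq_bigr do rewrite ffunE.
rewrite big_split /= (bigD1 i) //= big1 ?eqxx => [|k /negbTE-> //].
by rewrite (bigD1 j) //= big1 ?eqxx => [|k /negbTE-> //].
Qed.

(** Remove one unit at an index where [m] is positive: what remains has sum 1, hence is the
    indicator of a second index. *)
Lemma sum2_pair_multiplicity (n : nat) (m : {ffun 'I_n -> nat}) :
    (\sum_k m k = 2)%N ->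
  exists i j : 'I_n, (i <= j)%N /\ m = pair_multiplicity i j.
Proof.
move=> m2.
have ex1 (s : 'I_n -> nat) : (0 < \sum_k s k)%N -> exists i, (0 < s i)%N.
  move=> s0; apply: contrapT => /forallNP nex; move: s0; rewrite big1 // => k _.
  by apply/eqP; rewrite -leqn0 leqNgt; apply/negP.
have [|i mi] := ex1 m; first by rewrite m2.
(* The truncated subtraction is exact, because 1 is subtracted only at [i], where [m] is
   positive. *)
pose m' k := (m k - (k == i))%N.
have mE k : m k = ((k == i) + m' k)%N.
  by rewrite /m'; case: eqP => [->|_]; rewrite ?subnKC ?subn0.
have m'1 : (\sum_k m' k = 1)%N.
  apply: (@addnI 1); rewrite -[RHS]m2.
  rewrite [RHS](eq_bigr (fun k => (k == i) + m' k)%N) // big_split /=.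
  by rewrite [in RHS](bigD1 i) //= [in RHS]big1 ?eqxx // => k /negbTE->.
have [|j m'j] := ex1 m'; first by rewrite m'1.
have m'E k : m' k = (k == j).
  move: m'1; rewrite (bigD1 j) //=.
  case: eqP => [->|/eqP kj] /eqP; first by case: (m' j) m'j => [|[]].
  rewrite (bigD1 k) //=; case: (m' j) m'j => // a _; rewrite addSn eqSS.
  by rewrite !addn_eq0 => /and3P[_ /eqP].
have mij : m = pair_multiplicity i j by apply/ffunP => k; rewrite ffunE mE m'E.
have [ij|/ltnW ji] := leqP i j; first by exists i, j.
by exists j, i; split=> //; rewrite mij; apply/ffunP => k; rewrite !ffunE addnC.
Qed.

Section Multiplicity.
Variables (alpha : Type) (n : nat) (p : nanophrase alpha n).

Lemma sum_multiplicity (A : letters p) : (\sum_i multiplicity A i = 2)%N.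
Proof. by rewrite -[RHS](word_twice A); apply: eq_bigr => i _; rewrite ffunE. Qed.

Lemma multiplicity_pair (A : letters p) :
  exists i j : 'I_n, (i <= j)%N /\ multiplicity A = pair_multiplicity i j.
Proof. exact/sum2_pair_multiplicity/sum_multiplicity. Qed.

Lemma multiplicity_delete (A : letters p) (B : letters (delete A)) :
  multiplicity B = multiplicity (val B).
Proof.
apply/ffunP => i; rewrite !ffunE /= /delete_word.
elim: (word p i) => //= C w IHw.
case: insubP => [D _ <-|nCA] /=; first by rewrite IHw.
rewrite IHw; case: eqP => // CB.
by case/negP: nCA; rewrite CB; exact: (valP B).
Qed.

Lemma multiplicity_shift (nu : alpha -> alpha) (i : 'I_n) (A : letters p) :
  multiplicity (A : letters (shift nu p i)) = multiplicity A.
Proof.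
apply/ffunP => j; rewrite !ffunE /= /shift_word.
by case: eqP => // ->; apply/permP; rewrite perm_rot.
Qed.

(** A projection changes only if the first letter recurs in its own component, and then both its
    occurrences lie there. Invariance under [nu] is thus a condition on diagonal profiles alone. *)
Lemma shift_projE (nu : alpha -> alpha) (i : 'I_n) (A : letters p) :
  shift_proj nu i A = proj A \/
  shift_proj nu i A = nu (proj A) /\ multiplicity A = pair_multiplicity i i.
Proof.
rewrite /shift_proj; case wE: (word p i) => [|B x]; first by left.
case: andP => [[/eqP-> Bx]|]; [right; split=> // | by left].
have [j [k [_ mE]]] := multiplicity_pair B.
have : (1 < multiplicity B i)%N by rewrite ffunE wE /= eqxx ltnS -has_count has_pred1.
by rewrite mE ffunE; do 2![case: eqP => [<-|]].
Qed.

Lemma sum_delete (G : zmodType) (A : letters p) (w : {ffun 'I_n -> nat} -> alpha -> G) :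
  \sum_(B : letters p) w (multiplicity B) (proj B) =
  w (multiplicity A) (proj A)
  + \sum_(B : letters (delete A)) w (multiplicity B) (proj B).
Proof.
rewrite (bigD1 A) //=; congr (_ + _).
under [RHS]eq_bigr do rewrite multiplicity_delete.
by rewrite (big_sub _ (fun B => w (multiplicity B) (proj B))).
Qed.

End Multiplicity.

(** * Isomorphisms and cyclic equivalence *)

Section Isomorphic.
Variables (alpha : Type) (n : nat).

Lemma isomorphic_multiplicity (p q : nanophrase alpha n) (f : letters p -> letters q) :
    bijective f -> (forall i, word q i = map f (word p i)) ->
  forall A, multiplicity (f A) = multiplicity A.
Proof.
move=> /bij_inj finj fw A; apply/ffunP => i; rewrite !ffunE fw count_map.
by apply: eq_count => B /=; rewrite (inj_eq finj).
Qed.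

Lemma isomorphic_reproject (beta : Type) (p : nanophrase alpha n)
    (f g : letters p -> beta) : f =1 g -> isomorphic (reproject f) (reproject g).
Proof.
move=> fg; exists id; split=> [||i] /=; first by exists id.
  by move=> A; rewrite fg.
by rewrite map_id.
Qed.

(** The two phrases differ only in their proofs of [word_twice], so the identity is an
    isomorphism. *)
Lemma delete_reproject (beta : Type) (p : nanophrase alpha n)
    (f : letters p -> beta) (A : letters p) :
  isomorphic (@delete beta n (reproject f) A)
    (reproject (fun B : letters (delete A) => f (val B))).
Proof.
by exists id; split=> [|//|i] /=; [by exists id | rewrite map_id].
Qed.

End Isomorphic.

Section CyclicInvariance.
Variables (alpha : Type) (nu : alpha -> alpha) (n : nat).

Lemma cyclic_invariant_generators (G : Type) (u : nanophrase alpha n -> G) :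
    (forall p q, isomorphic p q -> u p = u q) ->
    (forall p i, u (shift nu p i) = u p) ->
  cyclic_invariant nu u.
Proof.
move=> u_iso u_shift p q; elim=> {p q} [p q /u_iso||||] //.
by move=> p q r _ -> _ ->.
Qed.

(** Since [nu_star] keeps unstarred symbols unstarred, each move on [p] is a move on [plain p]. This
    carries invariance from an extension back to the original map. *)
Lemma plain_cyclic_equiv (p q : nanophrase alpha n) :
  cyclic_equiv nu p q -> cyclic_equiv (nu_star nu) (plain p) (plain q).
Proof.
elim=> {p q} [p q [f [fbij fproj fw]]|p i|p|p q _|p q r _ IHpq _].
- by apply: cyclic_iso; exists f; split=> // A /=; rewrite fproj.
- apply: (cyclic_trans (cyclic_shift _ _ i)); apply: cyclic_iso.
  exists id; split=> [|A|j] /=; [by exists id| |by rewrite map_id].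
  by rewrite /shift_proj /=; case: (word p i) => // B x; case: ifP.
- exact: cyclic_refl.
- exact: cyclic_sym.
- exact: cyclic_trans.
Qed.

End CyclicInvariance.

(** * Affine invariants *)

Section Affine.
Variables (alpha : Type) (nu : alpha -> alpha) (n : nat) (G : zmodType).
Variables (g0 : G) (w : {ffun 'I_n -> nat} -> alpha -> G).

(** The analogue of a polynomial of degree at most 1, with the letters as variables. *)
Definition affine (p : nanophrase alpha n) : G :=
  g0 + \sum_(A : letters p) w (multiplicity A) (proj A).

Lemma affine_delete (p : nanophrase alpha n) (A : letters p) :
  affine p = w (multiplicity A) (proj A) + affine (delete A).
Proof. by rewrite /affine (sum_delete A) addrCA. Qed.

Definition base (x : alpha + alpha) : alpha :=
  match x with inl a => a | inr a => a end.

Definition all_singular_in (p : nanophrase (alpha + alpha) n)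
    (S : pred (letters p)) : bool :=
  [forall B : letters p, singular B ==> S B].

Lemma all_singular_inP (p : nanophrase (alpha + alpha) n) (S : pred (letters p)) :
  reflect (forall B, singular B -> S B) (all_singular_in S).
Proof. by apply: (iffP forallP) => S_all B; apply/implyP; apply: S_all. Qed.

(* Only a letter that is the sole singular one contributes; if there is no
   singular letter, then all of them do. *)
Definition affine_extension (p : nanophrase (alpha + alpha) n) : G :=
  g0 *+ all_singular_in (pred0 : pred (letters p))
  + \sum_(A : letters p | all_singular_in (pred1 A))
      w (multiplicity A) (base (proj A)).

Lemma affine_extension_plain (p : nanophrase alpha n) :
  affine_extension (plain p) = affine p.
Proof.
rewrite /affine_extension /affine.
have all_in S : all_singular_in (S : pred (letters (plain p))) by apply/forallP.
by rewrite all_in; under eq_bigl do rewrite all_in.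
Qed.

Lemma affine_extension_vanishes (p : nanophrase (alpha + alpha) n) :
  (1 < num_singular p)%N -> affine_extension p = 0.
Proof.
move/card_gt1P => [A [B [+ + AB]]]; rewrite !inE => sA sB.
rewrite /affine_extension big_pred0 => [|C].
  by case: all_singular_inP => [/(_ A sA)|_] //; rewrite addr0.
apply/negbTE/all_singular_inP => C_all; move: AB.
by rewrite (eqP (C_all A sA)) (eqP (C_all B sB)) eqxx.
Qed.

(** Desingularizing [A] and deleting it leave the same other singular letters, so the constants and
    the terms of all [B != A] cancel in the difference. What survives is the term of [A], present
    exactly when [A] is the only singular letter. *)
Lemma affine_extension_singular (p : nanophrase (alpha + alpha) n) (A : letters p) :
    singular A ->
  affine_extension p =
  affine_extension (desingularize A) - affine_extension (delete A).
Proof.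
move=> sA; rewrite /affine_extension.
have singularD (B : letters p) :
    singular (B : letters (desingularize A)) = (B != A) && singular B.
  rewrite /singular /=; have [_|_] := eqVneq B A => //.
  by case: (proj B).
have all_inD (S : pred (letters p)) :
    all_singular_in (S : pred (letters (desingularize A)))
    = all_singular_in (fun B => (B == A) || S B).
  apply: eq_forallb => B; rewrite singularD.
  by case: eqP => //=; rewrite implybT.
have all_in_delete (S : pred (letters p)) :
    all_singular_in ((fun B => S (val B)) : pred (letters (delete A)))
    = all_singular_in (fun B => (B == A) || S B).
  apply/all_singular_inP/all_singular_inP => S_all B sB.
    by case: eqP => //= /eqP BA; apply: (S_all (exist _ B BA)).
  by have := S_all _ sB; rewrite (negbTE (valP B)).
have -> : all_singular_in (pred0 : pred (letters p)) = false.
  by apply/negbTE/all_singular_inP => /(_ A sA).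
have -> : all_singular_in (pred0 : pred (letters (delete A)))
    = all_singular_in (pred0 : pred (letters (desingularize A))).
  by rewrite all_inD -(all_in_delete pred0).
rewrite add0r opprD addrACA subrr add0r.
rewrite !(big_mkcond (fun B => all_singular_in (pred1 B))) /=.
(* On the left, a letter other than [A] cannot be the sole singular one, so only the term of [A] can
   be nonzero. *)
rewrite [LHS](bigD1 A) //= [X in _ + X]big1 ?addr0 => [|B BA]; last first.
  by case: all_singular_inP => // /(_ A sA); rewrite /= eq_sym (negbTE BA).
rewrite [X in X - _](bigD1 A) //= all_inD.
have -> : all_singular_in (fun B => (B == A) || pred1 A B) = all_singular_in (pred1 A).
  by apply: eq_forallb => B /=; rewrite orbb.
rewrite eqxx.
have -> : base (unstar (proj A)) = base (proj A) by case: (proj A).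
(* The terms of [A] agree; the sums over the remaining letters have to cancel. *)
rewrite -[LHS]addr0 -addrA; congr (_ + _); apply/esym/eqP; rewrite subr_eq0; apply/eqP.
rewrite [LHS](big_sub _ (fun B : letters p =>
  if all_singular_in (pred1 B : pred (letters (desingularize A)))
  then w (multiplicity B) (base (if B == A then unstar (proj B) else proj B))
  else 0)).
apply: eq_bigr => B _; rewrite multiplicity_delete (negbTE (valP B)).
by rewrite all_inD -(all_in_delete (pred1 (val B))).
Qed.

Hypothesis w_nu : forall i a,
  w (pair_multiplicity i i) (nu a) = w (pair_multiplicity i i) a.

(** A shift preserves stars and multiplicities, and where it applies [nu] the profile is diagonal,
    so [w_nu] absorbs the change. *)
Lemma affine_extension_invariant : cyclic_invariant (nu_star nu) affine_extension.
Proof.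
apply: cyclic_invariant_generators => [p q [f [fbij fproj fw]]|p i].
  have [g fK gK] := fbij.
  have sf A : singular (f A) = singular A by rewrite /singular fproj.
  have all_f (S : pred (letters q)) :
      all_singular_in S = all_singular_in (fun A => S (f A)).
    apply/all_singular_inP/all_singular_inP => S_all A sA.
      by apply: S_all; rewrite sf.
    by rewrite -[A]gK; apply: S_all; rewrite -sf gK.
  rewrite /affine_extension (all_f pred0) (reindex f) /=; last exact: onW_bij.
  congr (_ + _); apply: eq_big => [A|A _].
    by rewrite all_f; apply: eq_forallb => B /=; rewrite (bij_eq fbij).
  by rewrite fproj (isomorphic_multiplicity fbij fw).
have s_shift (A : letters p) : singular (A : letters (shift (nu_star nu) p i)) = singular A.
  rewrite /singular /=; case: (shift_projE (nu_star nu) i A) => [->|[-> _]] //.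
  by case: (proj A).
have all_shift (S : pred (letters p)) :
    all_singular_in (S : pred (letters (shift (nu_star nu) p i))) = all_singular_in S.
  by apply: eq_forallb => A; rewrite s_shift.
rewrite /affine_extension (all_shift pred0); congr (_ + _).
apply: eq_big => [A|A _]; first exact: all_shift.
rewrite multiplicity_shift /=.
case: (@shift_projE _ _ p (nu_star nu) i A) => [->|[-> ->]] //.
have base_nu x : base (nu_star nu x) = nu (base x) by case: x.
by rewrite base_nu w_nu.
Qed.

Lemma affine_is_extension : is_extension nu affine affine_extension.
Proof.
split; [exact: affine_extension_invariant | exact: affine_extension_plain |].
exact: affine_extension_singular.
Qed.

Lemma affine_invariant : cyclic_invariant nu affine.
Proof.
move=> p q /plain_cyclic_equiv/affine_extension_invariant.
by rewrite !affine_extension_plain.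
Qed.

End Affine.

(** * Resolving singular letters *)

Section Star.
Variables (alpha : Type) (n : nat).

Definition star (p : nanophrase alpha n) (S : pred (letters p)) :
    nanophrase (alpha + alpha) n :=
  reproject (fun A : letters p => if S A then inr (proj A) else inl (proj A)).

Variables (nu : alpha -> alpha) (G : zmodType).
Variables (u : nanophrase alpha n -> G) (uhat : nanophrase (alpha + alpha) n -> G).
Hypothesis u_ext : is_extension nu u uhat.

Lemma extension_isomorphic (p q : nanophrase (alpha + alpha) n) :
  isomorphic p q -> uhat p = uhat q.
Proof. by case: u_ext => u_inv _ _ /(cyclic_iso (nu_star nu))/u_inv. Qed.

Lemma extension_star_plain (p : nanophrase alpha n) (S : pred (letters p)) :
  S =1 pred0 -> uhat (star S) = u p.
Proof.
case: (u_ext) => _ <- _ S0; apply: extension_isomorphic.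
by apply: isomorphic_reproject => A; rewrite S0.
Qed.

Lemma extension_star (p : nanophrase alpha n) (S : pred (letters p)) (A : letters p) :
    S A ->
  uhat (star S) = uhat (star (fun B : letters p => (B != A) && S B))
    - uhat (star (fun B : letters (delete A) => S (val B))).
Proof.
case: (u_ext) => _ _ u_sing SA.
rewrite (u_sing (star S) A) /singular /= ?SA //; congr (_ - _).
  apply: extension_isomorphic; apply: (@isomorphic_reproject _ _ _ p) => B /=.
  by case: eqP => //= _; case: (S B).
exact/extension_isomorphic/delete_reproject.
Qed.

Lemma extension_star1 (p : nanophrase alpha n) (A : letters p) :
  uhat (star (pred1 A)) = u p - u (delete A).
Proof.
rewrite (@extension_star _ _ A) /= ?eqxx //; congr (_ - _).
  by apply: extension_star_plain => B; rewrite /= andNb.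
by apply: extension_star_plain => B /=; apply/negbTE/(valP B).
Qed.

(** Resolving [A] leaves [B] as the only star, in [p] and in [delete A]. A second resolution gives
    the mixed second difference of [u], whichever extension [uhat] is taken. *)
Lemma extension_star2 (p : nanophrase alpha n) (A B : letters p) (BA : B != A) :
  uhat (star (pred2 A B)) =
  (u p - u (delete B))
  - (u (delete A) - u (delete (exist _ B BA : letters (delete A)))).
Proof.
rewrite (@extension_star _ _ A) /= ?eqxx //; congr (_ - _).
  rewrite -extension_star1; apply: extension_isomorphic.
  apply: (@isomorphic_reproject _ _ _ p) => C.
  by rewrite /=; case: eqP => //= ->; rewrite eq_sym (negbTE BA).
rewrite -extension_star1; apply: extension_isomorphic.
apply: (@isomorphic_reproject _ _ _ (delete A)) => C.
by rewrite /= (negbTE (valP C)).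
Qed.

End Star.

(** * One-letter nanophrases *)

Section Single.
Variables (alpha : Type) (n : nat).

Definition single_word (i j k : 'I_n) : seq unit := nseq (pair_multiplicity i j k) tt.

Lemma single_word_twice (i j : 'I_n) (A : unit) :
  (\sum_k count_mem A (single_word i j k) = 2)%N.
Proof.
rewrite -[RHS](sum_pair_multiplicity i j); apply: eq_bigr => k _.
by case: A; rewrite count_nseq mul1n.
Qed.

(** For [i = j] this is [AA] in one component; otherwise [A] stands once in each of components [i]
    and [j]. *)
Definition single (i j : 'I_n) (a : alpha) : nanophrase alpha n :=
  Nanophrase (fun _ : unit => a) (single_word_twice i j).

Lemma empty_twice (A : void) :
  (\sum_(k < n) count_mem A ([::] : seq void) = 2)%N.
Proof. by case: A. Qed.

Definition empty : nanophrase alpha n :=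
  @Nanophrase alpha n void (of_void alpha) (fun=> [::]) empty_twice.

Lemma card0_isomorphic_empty (p : nanophrase alpha n) :
  #|letters p| = 0%N -> isomorphic p empty.
Proof.
move=> p0; have np (A : letters p) : False.
  by have := max_card (pred1 A); rewrite p0 card1.
exists (fun A => match np A with end); split=> [|A|i]; [|by case: (np A)|].
  by exists (of_void _) => [A|[]]; case: (np A).
by rewrite /=; case: (word p i) => // A; case: (np A).
Qed.

(** Over a single letter a word is determined by its length, which is the multiplicity of that
    letter. *)
Lemma card1_isomorphic_single (p : nanophrase alpha n) (A : letters p) (i j : 'I_n) :
    #|letters p| = 1%N -> multiplicity A = pair_multiplicity i j ->
  isomorphic p (single i j (proj A)).
Proof.
move=> p1 mA; have pA (B : letters p) : B = A.
  by apply: (fintype_le1P _ A); rewrite p1.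
exists (fun=> tt); split=> [|B|k]; [|by rewrite (pA B)|].
  by exists (fun=> A) => [B|[]]; rewrite ?(pA B).
rewrite /= /single_word -mA ffunE; elim: (word p k) => //= B w <-.
by rewrite (pA B) eqxx.
Qed.

Lemma multiplicity_single (i j : 'I_n) (a : alpha) (A : letters (single i j a)) :
  multiplicity A = pair_multiplicity i j.
Proof. by apply/ffunP => k; case: A; rewrite ffunE count_nseq mul1n. Qed.

(** Rotating [AA] does not change the word, but [A] recurs in the tail, so its projection becomes
    [nu a]. This is the source of the relations in the diagonal groups. *)
Lemma isomorphic_shift_single (nu : alpha -> alpha) (i : 'I_n) (a : alpha) :
  isomorphic (shift nu (single i i a) i) (single i i (nu a)).
Proof.
exists id; split=> [|[]|k]; first by exists id.
  by rewrite /= /shift_proj /= /single_word ffunE eqxx.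
by rewrite map_id /= /shift_word /=; case: eqP => // ->; rewrite /single_word ffunE eqxx.
Qed.

End Single.

Lemma affine_finite_type (alpha : Type) (nu : alpha -> alpha) (n : nat) (G : zmodType)
    (g0 : G) (w : {ffun 'I_n -> nat} -> alpha -> G) (i : 'I_n) (a : alpha) :
    (forall j b, w (pair_multiplicity j j) (nu b) = w (pair_multiplicity j j) b) ->
    w (pair_multiplicity i i) a != 0 ->
  finite_type_of_degree nu (affine g0 w) 1.
Proof.
move=> w_nu wa; split; first exact: affine_invariant.
  exists (affine_extension g0 w); first exact: affine_is_extension.
  exact: affine_extension_vanishes.
(* Only [k = 0] has to be excluded: starring the letter of [single i i a] gives a phrase on which
   every extension takes the nonzero value [w (pair_multiplicity i i) a]. *)
case=> // -[uhat u_ext u_van]; case/eqP: wa.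
pose A : letters (single i i a) := tt.
rewrite -(u_van (star (pred1 A))); last by apply/card_gt0P; exists A; rewrite inE.
by rewrite (extension_star1 u_ext) (affine_delete g0 w A) addrK multiplicity_single.
Qed.

(** * Invariants of degree at most 1 *)

Section DegreeOne.
Variables (alpha : Type) (nu : alpha -> alpha) (n : nat) (H : zmodType).
Variables (v : nanophrase alpha n -> H) (k : nat).
Hypothesis v_inv : cyclic_invariant nu v.
Hypothesis v_van : extension_vanishes_above nu v k.
Hypothesis k1 : (k <= 1)%N.

Definition single_value (i j : 'I_n) (a : alpha) : H :=
  v (single i j a) - v (empty alpha n).

Lemma single_value_nu (i : 'I_n) (a : alpha) :
  single_value i i (nu a) = single_value i i a.
Proof.
rewrite /single_value -(v_inv (cyclic_iso nu (isomorphic_shift_single nu i a))).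
by rewrite -(v_inv (cyclic_shift _ _ _)).
Qed.

Lemma second_difference (p : nanophrase alpha n) (A B : letters p) (BA : B != A) :
  v p = v (delete A) + v (delete B) - v (delete (exist _ B BA : letters (delete A))).
Proof.
case: v_van => vhat v_ext v0; apply/eqP; rewrite -subr_eq0.
rewrite -[X in _ == X](v0 (star (pred2 A B))).
  by rewrite (extension_star2 v_ext BA) !opprD !opprK !addrA [_ - v (delete B)]addrAC.
(* Two distinct starred letters exceed the bound [k], which is at most 1. *)
apply: (leq_ltn_trans k1); apply/card_gt1P; exists A, B.
by rewrite !inE /singular /= !eqxx orbT eq_sym BA.
Qed.

(** Prescribing [w] for [i <= j] suffices, since every letter has a profile of that form. The values
    of [w] at other arguments stay free, so it can later be read off from a homomorphism. *)
Lemma degree1_affine (w : {ffun 'I_n -> nat} -> alpha -> H) :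
    (forall (i j : 'I_n) a, (i <= j)%N ->
       w (pair_multiplicity i j) a = single_value i j a) ->
  v =1 affine (v (empty alpha n)) w.
Proof.
(* The induction runs on an upper bound for the number of letters, because [second_difference] also
   involves a phrase with two letters fewer. *)
move=> wE p; move: {2}#|letters p| (leqnn #|letters p|) => N.
elim: N p => [|N IHN] p pN.
  have p0 : #|letters p| = 0%N by apply/eqP; rewrite -leqn0.
  rewrite /affine big_pred0 ?addr0; last first.
    by move=> A; have := max_card (pred1 A); rewrite p0 card1.
  exact/v_inv/cyclic_iso/card0_isomorphic_empty.
have card_delete (q : nanophrase alpha n) (A : letters q) :
    #|letters (delete A)| = #|letters q|.-1.
  by rewrite /= card_sig -(cardC1 A); apply: eq_card => B; rewrite !inE.
case: (leqP 2 #|letters p|) => [/card_gt1P[A [B [_ _ AB]]]|p2].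
  have BA : B != A by rewrite eq_sym.
  pose B' : letters (delete A) := exist _ B BA.
  have dN C : (#|letters (@delete _ _ p C)| <= N)%N.
    by rewrite card_delete -ltnS; case: #|_| pN.
  have dB'N : (#|letters (delete B')| <= N)%N.
    by rewrite card_delete (leq_trans (leq_pred _)).
  rewrite (second_difference BA) (IHN _ (dN A)) (IHN _ (dN B)) (IHN _ dB'N).
  (* Deleting [B] removes the same weight from [p] as from [delete A], so [affine] satisfies the
     same second-difference identity as [v]. *)
  rewrite (affine_delete _ w B) (affine_delete _ w B') addrAC.
  by rewrite multiplicity_delete addrK.
case: (posnP #|letters p|) => [p0|p_gt0].
  by apply: IHN; rewrite p0.
have p1 : #|letters p| = 1%N by apply/eqP; rewrite eqn_leq p_gt0 -ltnS p2.
have [A _] := card_gt0P p_gt0.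
have [i [j [ij mA]]] := multiplicity_pair A.
have iso_p := card1_isomorphic_single p1 mA.
rewrite (v_inv (cyclic_iso nu iso_p)) (affine_delete _ w A) mA wE //.
rewrite -(IHN _ _); last by rewrite card_delete p1.
have iso_d : isomorphic (delete A) (empty alpha n).
  by apply: card0_isomorphic_empty; rewrite card_delete p1.
by rewrite (v_inv (cyclic_iso nu iso_d)) /single_value subrK.
Qed.

End DegreeOne.

(** * The linking matrix *)

Section Expand.
Variables (alpha : finType) (H : zmodType).

(** The homomorphism given by the universal property of the free abelian group. *)
Definition expand (d : alpha -> H) (x : free_ab alpha) : H := \sum_a d a *~ x a.

Lemma expandB (d : alpha -> H) (x y : free_ab alpha) :
  expand d (x - y) = expand d x - expand d y.
Proof. by rewrite -sumrB; apply: eq_bigr => a _; rewrite !ffunE mulrzBr. Qed.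

HB.instance Definition _ (d : alpha -> H) :=
  GRing.isZmodMorphism.Build (free_ab alpha) H (expand d) (expandB d).

Lemma expand_gen (d : alpha -> H) (a : alpha) : expand d (gen a) = d a.
Proof.
rewrite /expand (bigD1 a) //= big1 ?addr0 ?ffunE ?eqxx ?mulr1z // => b /negbTE ba.
by rewrite ffunE ba mulr0z.
Qed.

Lemma expand_relations (nu : alpha -> alpha) (d : alpha -> H) (x : free_ab alpha) :
  (forall a, d (nu a) = d a) -> x \in relations nu -> expand d x = 0.
Proof.
move=> d_nu /asboolP[c ->]; rewrite raddf_sum big1 // => a _.
by rewrite raddfMz raddfB /= !expand_gen d_nu subrr mul0rz.
Qed.

Variables (nu : alpha -> alpha) (d : alpha -> H).
Hypothesis d_nu : forall a, d (nu a) = d a.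

Lemma expand_eqmod (x y : free_ab alpha) :
  (x = y %[mod quot_ab nu])%qT -> expand d x = expand d y.
Proof.
move=> /eqP; rewrite -Quotient.idealrBE => /(expand_relations d_nu)/eqP.
by rewrite expandB subr_eq0 => /eqP.
Qed.

(** The map induced on the quotient, computed on a chosen representative; by [expand_eqmod] the
    choice is immaterial when [d] is invariant under [nu]. *)
Definition quot_expand (x : quot_ab nu) : H := expand d (repr x).

Lemma quot_expand_pi (x : free_ab alpha) :
  quot_expand (\pi_(quot_ab nu) x)%qT = expand d x.
Proof. by apply: expand_eqmod; rewrite reprK. Qed.

Lemma quot_expandB : zmod_morphism quot_expand.
Proof.
move=> x y; rewrite -[x]reprK -[y]reprK -raddfB !quot_expand_pi.
exact: expandB.
Qed.

Lemma quot_expand0 : quot_expand 0 = 0.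
Proof. by rewrite -(subrr 0) quot_expandB subrr. Qed.

End Expand.

(** * The linking matrix as a sum of letter weights *)

Section Link.
Variables (alpha : finType) (nu : alpha -> alpha) (n : nat).

Lemma quot_gen_nu (a : alpha) : quot_gen nu (nu a) = quot_gen nu a.
Proof.
apply/esym/eqP; rewrite -Quotient.idealrBE; apply/asboolP.
(* The indicator of [a] as coefficient function selects the single relation [gen a - gen (nu a)]. *)
exists (fun b => (b == a)%:R); rewrite (bigD1 a) //= eqxx big1 ?addr0 //.
by move=> b /negbTE->.
Qed.

(** Sending every generator to 1 respects the relations, so it descends to the quotient, where the
    class of [a] has the nonzero image 1. *)
Lemma quot_gen_neq0 (a : alpha) : quot_gen nu a != 0.
Proof.
apply/eqP => qa0; have := @quot_expand_pi _ _ nu (fun=> 1 : int) (fun=> erefl) (gen a).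
rewrite -/(quot_gen nu a) qa0 -[0](raddf0 \pi_(quot_ab nu)%qT) quot_expand_pi //.
by rewrite expand_gen raddf0.
Qed.

Definition link (m : {ffun 'I_n -> nat}) (a : alpha) : linking_group nu n :=
  ([ffun ij : upper_pair n =>
      if (m (val ij).1 == 1%N) && (m (val ij).2 == 1%N) then gen a else 0],
   [ffun i => if m i == 2%N then quot_gen nu a else 0]).

Lemma linking_matrixE (p : nanophrase alpha n) :
  linking_matrix nu p = \sum_(A : letters p) link (multiplicity A) (proj A).
Proof.
rewrite [RHS]surjective_pairing (raddf_sum fst) (raddf_sum snd); congr pair.
  apply/ffunP => ij; rewrite sum_ffunE ffunE big_mkcond /=.
  by apply: eq_bigr => A _; rewrite inE !ffunE.
apply/ffunP => i; rewrite sum_ffunE ffunE big_mkcond /=.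
by apply: eq_bigr => A _; rewrite inE !ffunE.
Qed.

Lemma link_nu (i : 'I_n) (a : alpha) :
  link (pair_multiplicity i i) (nu a) = link (pair_multiplicity i i) a.
Proof.
congr pair; apply/ffunP => j; rewrite !ffunE ?quot_gen_nu //.
(* A doubled indicator is 0 or 2, never 1, so the off-diagonal entries vanish on both sides. *)
by do 2!case: eqP.
Qed.

Lemma link_neq0 (i : 'I_n) (a : alpha) : link (pair_multiplicity i i) a != 0.
Proof.
apply/eqP => /(congr1 snd)/ffunP/(_ i); rewrite !ffunE eqxx.
exact/eqP/quot_gen_neq0.
Qed.

Variables (H : zmodType) (e : H) (d : 'I_n -> 'I_n -> alpha -> H).
Hypothesis d_nu : forall i a, d i i (nu a) = d i i a.

(** Assembled from the universal properties of the summands; the integer factor carries the constant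
    term [e]. *)
Definition from_linking (x : linking_group nu n * int) : H :=
  e *~ x.2
  + (\sum_(ij : upper_pair n) expand (d (val ij).1 (val ij).2) (x.1.1 ij)
     + \sum_(i < n) quot_expand (d i i) (x.1.2 i)).

Lemma from_linkingB : zmod_morphism from_linking.
Proof.
move=> x y; rewrite /from_linking /= mulrzBr.
under eq_bigr do rewrite !ffunE expandB.
under [X in _ + (_ + X)]eq_bigr do rewrite !ffunE quot_expandB //.
by rewrite !sumrB [X in _ + X]addrACA -opprD [LHS]addrACA -opprD.
Qed.

(** The weight of a letter with profile [(i, j)] has a single nonzero entry, in position [(i, j)],
    so one term of the sums survives. *)
Lemma from_linking_link (i j : 'I_n) (a : alpha) :
  (i <= j)%N -> from_linking (link (pair_multiplicity i j) a, 0) = d i j a.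
Proof.
rewrite leq_eqVlt /from_linking mulr0z add0r => /predU1P[/val_inj <-{j}|ij].
  rewrite big1 ?add0r => [|[[k l] /= kl] _]; last first.
    by rewrite ffunE /= !ffunE; case: (k == i); rewrite /= raddf0.
  rewrite (bigD1 i) //= ffunE ffunE eqxx quot_expand_pi // expand_gen.
  rewrite big1 ?addr0 // => k /negbTE ki.
  by rewrite !ffunE ki /= quot_expand0.
have ijF : (i == j) = false by apply/negbTE; rewrite neq_ltn ij.
rewrite [X in _ + X]big1 ?addr0 => [|k _]; last first.
  rewrite !ffunE; have [->|_] := eqVneq k i.
    by rewrite ijF /= quot_expand0.
  by case: (k == j); rewrite /= quot_expand0.
rewrite (bigD1 (exist _ (i, j) ij)) //= ffunE /= !ffunE !eqxx.
rewrite [j == i]eq_sym ijF /= expand_gen big1 ?addr0 //.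
(* Another pair [k < l] with both multiplicities 1 would have to be [(j, i)], which the order
   excludes. *)
case=> [[k l] /= kl]; rewrite -val_eqE /= xpair_eqE !ffunE /=.
have [ki|_] := eqVneq k i.
  rewrite ki ijF; have [//|_ _] := eqVneq l j.
  have [li|_] := eqVneq l i; first by move: kl; rewrite ki li ltnn.
  by rewrite /= raddf0.
have [kj|_] := eqVneq k j; last by rewrite /= raddf0.
have [li|_] := eqVneq l i; first by move: kl; rewrite kj li ltnNge ltnW.
have [lj|_] := eqVneq l j; first by move: kl; rewrite kj lj ltnn.
by rewrite raddf0.
Qed.

End Link.

Lemma linking_affine (alpha : finType) (nu : alpha -> alpha) (n : nat) :
  @linking_matrix alpha nu n = affine 0 (@link alpha nu n).
Proof. by apply/funext => p; rewrite /affine add0r linking_matrixE. Qed.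

Lemma direct_sum_affine (alpha : finType) (nu : alpha -> alpha) (n : nat) :
  direct_sum (@linking_matrix alpha nu n) (@iota1 alpha n)
  = affine (0, 1) (fun m a => (link nu m a, 0)).
Proof.
apply/funext => p; rewrite /affine /direct_sum linking_matrixE.
rewrite [X in _ = _ + X]surjective_pairing (raddf_sum fst) (raddf_sum snd) /=.
by rewrite big1_eq; congr pair; rewrite /= ?add0r ?addr0.
Qed.

(** This reduces the factorization of [v] to comparing a constant and the weights of single
    letters. *)
Lemma additive_affine (alpha : finType) (nu : alpha -> alpha) (n : nat) (H : zmodType)
    (f : {additive linking_group nu n * int -> H}) (p : nanophrase alpha n) :
  f (direct_sum (@linking_matrix alpha nu n) (@iota1 alpha n) p)
  = affine (f (0, 1)) (fun m a => f (link nu m a, 0)) p.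
Proof. by rewrite direct_sum_affine /affine raddfD raddf_sum. Qed.

Theorem theorem6p3 (alpha : finType) (nu : alpha -> alpha) (n : nat)
    (alpha_nonempty : (0 < #|alpha|)%N) (n_pos : (0 < n)%N) (nuK : involutive nu) :
  finite_type_of_degree nu (@linking_matrix alpha nu n) 1 /\
  universal_of_degree nu (direct_sum (@linking_matrix alpha nu n) (@iota1 alpha n)) 1.
Proof.
(* A symbol and a component provide a one-letter phrase of nonzero weight, which excludes degree
   0. *)
have [a _] := card_gt0P alpha_nonempty; pose i := Ordinal n_pos.
split; [|split].
- rewrite linking_affine.
  by apply: (@affine_finite_type _ _ _ _ _ _ i a); [exact: link_nu | exact: link_neq0].
- rewrite direct_sum_affine; apply: (@affine_finite_type _ _ _ _ _ _ i a).
    by move=> j b; rewrite link_nu.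
  by rewrite xpair_eqE negb_and link_neq0.
move=> H v k k1 [v_inv v_van _].
(* This invariance lets the diagonal values of [v] descend to the quotient groups. *)
have d_nu := single_value_nu v_inv.
pose f := GRing.isZmodMorphism.Build (linking_group nu n * int)%type H
  (from_linking (v (empty alpha n)) (single_value v)) (from_linkingB _ d_nu).
pose F : {additive linking_group nu n * int -> H} :=
  HB.pack (from_linking (v (empty alpha n)) (single_value v)) f.
exists F => p; rewrite additive_affine.
have -> : F (0, 1) = v (empty alpha n).
  rewrite /F /= /from_linking mulr1z !big1 ?addr0 // => *; rewrite !ffunE ?raddf0 //.
  exact: quot_expand0.
apply: (degree1_affine v_inv v_van k1) => j l b.
exact: from_linking_link.
Qed.
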